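(* Let $F:\mathsf{Rack}\to\mathsf{GLQ}$ be the functor sending a rack $R=(X,s)$ to the GL-quandle $F(R):=(X,\widetilde{s},\pi_R)$ with $\widetilde{s}_x:=\pi_R^{-1}s_x$, and let $G:\mathsf{GLQ}\to\mathsf{Rack}$ be the functor sending a GL-quandle $Q=(X,s,\mathtt{u})$ to the rack $G(Q):=(X,\hat{s})$ with $\hat{s}_x:=\mathtt{u}s_x$; both functors act as the identity on the underlying set maps of morphisms. Then $F$ and $G$ are isomorphisms of categories $\mathsf{Rack}\cong\mathsf{GLQ}$, and they restrict to isomorphisms $\mathsf{Rack}_{\mathrm{med}}\cong\mathsf{GLQ}_{\mathrm{med}}$.
   Context: For a set $X$, $S_X$ is the group of permutations of $X$; products of maps denote composition. A rack is a pair $(X,s)$ of a set $X$ and a map $s:X\to S_X$, $x\mapsto s_x$, such that $s_xs_y=s_{s_x(y)}s_x$ for all $x,y\in X$; it is a quandle if $s_x(x)=x$ for all $x$; it is medial if $s_{s_x(z)}s_y(a)=s_{s_x(y)}s_z(a)$ for all $x,y,z,a\in X$, i.e. if $(x,y)\mapsto s_x(y)$ is a rack homomorphism from the product rack $X\times X$ to $X$. A rack homomorphism $(X,s)\to(Y,t)$ is a map $\varphi:X\to Y$ with $\varphi s_x=t_{\varphi(x)}\varphi$ for all $x\in X$. For a rack $R=(X,s)$, $\pi_R:X\to X$ is $x\mapsto s_x(x)$; it is a rack automorphism of $R$. A GL-structure on $R$ is a rack automorphism $\mathtt{u}$ of $R$ such that $\mathtt{u}s_x=s_x\mathtt{u}$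 for all $x\in X$; the pair $(R,\mathtt{u})=(X,s,\mathtt{u})$ is a GL-rack, and a GL-quandle (resp. medial GL-rack) if $R$ is a quandle (resp. medial). A GL-rack homomorphism $(R_1,\mathtt{u}_1)\to(R_2,\mathtt{u}_2)$ is a rack homomorphism $\varphi$ with $\varphi\mathtt{u}_1=\mathtt{u}_2\varphi$. $\mathsf{Rack}$ is the category of racks and rack homomorphisms, $\mathsf{Rack}_{\mathrm{med}}$ its full subcategory of medial racks; $\mathsf{GLQ}$ is the category of GL-quandles and GL-rack homomorphisms, $\mathsf{GLQ}_{\mathrm{med}}$ its full subcategory of medial GL-quandles. *)

(* Defs.v *)
From mathcomp Require Import ssreflect ssrfun ssrbool.
From Stdlib Require Import ProofIrrelevance.

Set Implicit Arguments.
Unset Strict Implicit.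
Unset Printing Implicit Defensive.

(* Objects and morphisms are compared by Leibniz equality, so
   that isomorphism of categories has its usual strict meaning. *)

Record category := Category {
  obj :> Type;
  hom : obj -> obj -> Type;
  idm : forall a, hom a a;
  compm : forall a b c, hom b c -> hom a b -> hom a c;
  compm1 : forall a b (f : hom a b), compm f (idm a) = f;
  comp1m : forall a b (f : hom a b), compm (idm b) f = f;
  compmA : forall a b c d (h : hom c d) (g : hom b c) (f : hom a b),
    compm h (compm g f) = compm (compm h g) f
}.

Record functor (C D : category) := Functor {
  fobj :> C -> D;
  fmap : forall a b : C, hom a b -> hom (fobj a) (fobj b);
  fmap1 : forall a : C, fmap (idm a) = idm (fobj a);
  fmapM : forall (a b c : C) (g : hom b c) (f : hom a b),
    fmap (compm g f) = compm (fmap g) (fmap f)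
}.

Definition id_functor (C : category) : functor C C :=
  @Functor C C id (fun a b f => f) (fun a => erefl) (fun a b c g f => erefl).

Definition comp_functor (C D E : category)
    (K : functor D E) (H : functor C D) : functor C E :=
  @Functor C E (fun a => K (H a)) (fun a b f => fmap K (fmap H f))
    (fun a => etrans (congr1 (@fmap _ _ K _ _) (fmap1 H a)) (fmap1 K (H a)))
    (fun a b c g f => etrans (congr1 (@fmap _ _ K _ _) (fmapM H g f))
                             (fmapM K (fmap H g) (fmap H f))).

Definition inverse_functors (C D : category)
    (H : functor C D) (K : functor D C) : Prop :=
  comp_functor K H = id_functor C /\ comp_functor H K = id_functor D.

Definition is_isomorphism (C D : category) (H : functor C D) : Prop :=
  exists K : functor D C, inverse_functors H K.

Definition full_subcategory (C : category) (P : C -> Prop) : category :=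
  @Category {a : C | P a} (fun a b => hom (sval a) (sval b))
    (fun a => idm (sval a)) (fun a b c g f => compm g f)
    (fun a b f => compm1 f) (fun a b f => comp1m f)
    (fun a b c d h g f => compmA h g f).

Definition restrict_functor (C D : category) (P : C -> Prop) (Q : D -> Prop)
    (H : functor C D) (HPQ : forall a, P a -> Q (H a)) :
    functor (full_subcategory P) (full_subcategory Q) :=
  @Functor (full_subcategory P) (full_subcategory Q)
    (fun a => exist Q (H (sval a)) (HPQ (sval a) (svalP a)))
    (fun a b f => fmap H f)
    (fun a => fmap1 H (sval a)) (fun a b c g f => fmapM H g f).

(* MathComp's {perm T} needs T finite. *)
Record perm (X : Type) := Perm {
  pfun :> X -> X;
  pinv : X -> X;
  pfunK : cancel pfun pinv;
  pinvK : cancel pinv pfun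
}.

Definition permV (X : Type) (p : perm X) : perm X := Perm (pinvK p) (pfunK p).

Definition permM (X : Type) (p q : perm X) : perm X :=
  Perm (can_comp (pfunK p) (pfunK q)) (can_comp (pinvK q) (pinvK p)).

Definition rack_axiom (X : Type) (s : X -> perm X) : Prop :=
  forall x y a, s x (s y a) = s (s x y) (s x a).

Record rack := Rack {
  rack_sort :> Type;
  rack_op : rack_sort -> perm rack_sort;
  rackP : rack_axiom rack_op
}.

Definition quandle_axiom (X : Type) (s : X -> perm X) : Prop :=
  forall x, s x x = x.

Definition medial (R : rack) : Prop :=
  forall x y z a : R,
    rack_op (rack_op x z) (rack_op y a) = rack_op (rack_op x y) (rack_op z a).

Definition is_rack_hom (X Y : Type) (s : X -> perm X) (t : Y -> perm Y)
    (phi : X -> Y) : Prop :=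
  forall x a, phi (s x a) = t (phi x) (phi a).

(* A permutation that is a rack homomorphism is a rack automorphism: its inverse
   is again a homomorphism. *)
Definition GL_structure (X : Type) (s : X -> perm X) (u : perm X) : Prop :=
  is_rack_hom s s u /\ (forall x a, u (s x a) = s x (u a)).

Record glrack := GLRack {
  glrack_rack :> rack;
  gl_u : perm glrack_rack;
  glrackP : GL_structure (@rack_op glrack_rack) gl_u
}.

Record glquandle := GLQuandle {
  glquandle_glrack :> glrack;
  glquandleP : quandle_axiom (@rack_op glquandle_glrack)
}.

Record rack_hom (R1 R2 : rack) := RackHom {
  rack_hom_fun :> R1 -> R2;
  rack_homP : is_rack_hom (@rack_op R1) (@rack_op R2) rack_hom_fun
}.

Record glrack_hom (Q1 Q2 : glrack) := GLRackHom {
  glrack_hom_rack :> rack_hom Q1 Q2;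
  glrack_homP : forall a, glrack_hom_rack (gl_u Q1 a) = gl_u Q2 (glrack_hom_rack a)
}.

Lemma rack_hom_eq (R1 R2 : rack) (f g : rack_hom R1 R2) :
  rack_hom_fun f = rack_hom_fun g -> f = g.
Proof.
case: f g => [f fP] [g gP] /= fg; case: g / fg gP => gP.
by rewrite (proof_irrelevance _ fP gP).
Qed.

Lemma glrack_hom_eq (Q1 Q2 : glrack) (f g : glrack_hom Q1 Q2) :
  rack_hom_fun f = rack_hom_fun g -> f = g.
Proof.
case: f g => [f fP] [g gP] /= /rack_hom_eq fg; case: g / fg gP => gP.
by rewrite (proof_irrelevance _ fP gP).
Qed.

Definition rack_hom_id (R : rack) : rack_hom R R :=
  @RackHom R R id (fun x a => erefl).

Lemma rack_hom_compP (R1 R2 R3 : rack)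
    (g : rack_hom R2 R3) (f : rack_hom R1 R2) :
  is_rack_hom (@rack_op R1) (@rack_op R3) (g \o f).
Proof. by move=> x a /=; rewrite !rack_homP. Qed.

Definition rack_hom_comp (R1 R2 R3 : rack)
    (g : rack_hom R2 R3) (f : rack_hom R1 R2) : rack_hom R1 R3 :=
  RackHom (rack_hom_compP g f).

Definition glrack_hom_id (Q : glrack) : glrack_hom Q Q :=
  @GLRackHom Q Q (rack_hom_id Q) (fun a => erefl).

Lemma glrack_hom_compP (Q1 Q2 Q3 : glrack)
    (g : glrack_hom Q2 Q3) (f : glrack_hom Q1 Q2) (a : Q1) :
  rack_hom_comp g f (gl_u Q1 a) = gl_u Q3 (rack_hom_comp g f a).
Proof. by rewrite /= !glrack_homP. Qed.

Definition glrack_hom_comp (Q1 Q2 Q3 : glrack)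
    (g : glrack_hom Q2 Q3) (f : glrack_hom Q1 Q2) : glrack_hom Q1 Q3 :=
  GLRackHom (glrack_hom_compP g f).

Definition RackCat : category :=
  @Category rack rack_hom rack_hom_id rack_hom_comp
    (fun a b f => ltac:(exact: rack_hom_eq))
    (fun a b f => ltac:(exact: rack_hom_eq))
    (fun a b c d h g f => ltac:(exact: rack_hom_eq)).

Definition GLQ : category :=
  @Category glquandle (fun Q1 Q2 => glrack_hom Q1 Q2)
    (fun Q => glrack_hom_id Q)
    (fun Q1 Q2 Q3 g f => glrack_hom_comp g f)
    (fun a b f => ltac:(exact: glrack_hom_eq))
    (fun a b f => ltac:(exact: glrack_hom_eq))
    (fun a b c d h g f => ltac:(exact: glrack_hom_eq)).

Definition medial_rack (R : RackCat) : Prop := medial R.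
Definition medial_glquandle (Q : GLQ) : Prop := medial (Q : glquandle).

Definition Rack_med : category := full_subcategory medial_rack.
Definition GLQ_med : category := full_subcategory medial_glquandle.

Section CanonicalAutomorphism.

Variable R : rack.
Implicit Types x y a : R.

Let s := @rack_op R.

Definition rack_pi_fun x : R := s x x.
(* The inverse of pi_R is y |-> s_y^-1(y). *)
Definition rack_pi_inv x : R := pinv (s x) x.

Lemma op_rack_pi x a : s (rack_pi_fun x) a = s x a.
Proof. by rewrite -{1}(pinvK (s x) a) -(rackP x x) pinvK. Qed.

Lemma op_rack_pi_inv x a : s (rack_pi_inv x) a = s x a.
Proof.
have h := rackP x (rack_pi_inv x) a.
rewrite -/s pinvK in h.
exact: (can_inj (pfunK (s x))).
Qed.

Lemma rack_pi_funK : cancel rack_pi_fun rack_pi_inv.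
Proof.
move=> x; apply: (can_inj (pfunK (s (rack_pi_fun x)))).
by rewrite pinvK op_rack_pi.
Qed.

Lemma rack_pi_invK : cancel rack_pi_inv rack_pi_fun.
Proof. by move=> x; rewrite /rack_pi_fun op_rack_pi_inv pinvK. Qed.

Definition rack_pi : perm R := Perm rack_pi_funK rack_pi_invK.

Lemma rack_piC x a : rack_pi (s x a) = s x (rack_pi a).
Proof. by rewrite /= /rack_pi_fun [RHS]rackP. Qed.

Lemma rack_piVC x a : permV rack_pi (s x a) = s x (permV rack_pi a).
Proof.
apply: (can_inj (pfunK rack_pi)).
by rewrite rack_piC !(pinvK rack_pi).
Qed.

Definition F_op (x : R) : perm R := permM (permV rack_pi) (rack_op x).

Lemma F_opE x a : F_op x a = permV rack_pi (s x a).
Proof. by []. Qed.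

Lemma F_rackP : rack_axiom F_op.
Proof.
move=> x y a; rewrite !F_opE.
by rewrite -[in RHS]/(s _ _) op_rack_pi_inv -!rack_piVC rackP.
Qed.

Lemma F_quandleP : quandle_axiom F_op.
Proof. by move=> x; rewrite F_opE; exact: rack_pi_funK. Qed.

Lemma F_GLP : GL_structure F_op rack_pi.
Proof.
have piC x a : rack_pi (F_op x a) = F_op x (rack_pi a).
  rewrite !F_opE -rack_piC.
  exact: etrans (pinvK rack_pi _) (esym (pfunK rack_pi _)).
by split=> // x a; rewrite piC !F_opE op_rack_pi.
Qed.

Definition F_obj : glquandle :=
  @GLQuandle (@GLRack (Rack F_rackP) rack_pi F_GLP) F_quandleP.

End CanonicalAutomorphism.

Section FMorphism.

Variables (R1 R2 : rack) (phi : rack_hom R1 R2).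

Lemma F_hom_pi a : phi (rack_pi R1 a) = rack_pi R2 (phi a).
Proof. exact: rack_homP. Qed.

Lemma F_hom_op : is_rack_hom (@F_op R1) (@F_op R2) phi.
Proof.
move=> x a; rewrite !F_opE -rack_homP.
by apply: (can_inj (pfunK (rack_pi R2))); rewrite -F_hom_pi !(pinvK (rack_pi _)).
Qed.

Definition F_mor : glrack_hom (F_obj R1) (F_obj R2) :=
  @GLRackHom (F_obj R1) (F_obj R2) (@RackHom (F_obj R1) (F_obj R2) phi F_hom_op)
    F_hom_pi.

End FMorphism.

Definition F : functor RackCat GLQ :=
  @Functor RackCat GLQ F_obj F_mor
    (fun a => ltac:(exact: glrack_hom_eq))
    (fun a b c g f => ltac:(exact: glrack_hom_eq)).

Section GObject.

Variable Q : glquandle.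

Let s := @rack_op Q.
Let u := gl_u Q.

Definition G_op (x : Q) : perm Q := permM (gl_u Q) (rack_op x).

Lemma op_gl_u x a : s (u x) a = s x a.
Proof.
have [uhom uC] := glrackP Q.
by rewrite -[a](pinvK u) -uhom uC.
Qed.

Lemma G_rackP : rack_axiom G_op.
Proof.
have [_ uC] := glrackP Q.
move=> x y a; rewrite /G_op /=.
by rewrite -/s -/u op_gl_u -[s x (u _)]uC -[s _ (u _)]uC rackP.
Qed.

Definition G_obj : rack := Rack G_rackP.

End GObject.

Section GMorphism.

Variables (Q1 Q2 : glquandle) (phi : glrack_hom Q1 Q2).

Lemma G_hom_op : is_rack_hom (@G_op Q1) (@G_op Q2) phi.
Proof. by move=> x a; rewrite /G_op /= glrack_homP rack_homP. Qed.

Definition G_mor : rack_hom (G_obj Q1) (G_obj Q2) :=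
  @RackHom (G_obj Q1) (G_obj Q2) phi G_hom_op.

End GMorphism.

Definition G : functor GLQ RackCat :=
  @Functor GLQ RackCat G_obj G_mor
    (fun a => ltac:(exact: rack_hom_eq)) (fun a b c g f => ltac:(exact: rack_hom_eq)).

(* Main.v *)
From mathcomp Require Import ssreflect ssrfun ssrbool.
From Stdlib Require Import ProofIrrelevance FunctionalExtensionality.
Require Import Defs.

(** The maps [pi_{G(Q)}] and [u_Q] coincide because [Q] is a quandle, and
    composing [s_x] with [u] and then with [u^-1] (or in the other order) gives
    back [s_x]; so [F] and [G] are mutually inverse on objects. On morphisms both
    are the identity of underlying maps, which makes every transport along these
    object equalities trivial: it lies over the identity of the carrier. *)

Set Implicit Arguments.
Unset Strict Implicit.
Unset Printing Implicit Defensive.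

Definition cast (A B : Type) (e : A = B) (x : A) : B := ecast T T e x.

(* Also applies to [e : A = B] with [A] and [B] merely convertible. *)
Lemma cast_id (A : Type) (e : A = A) (x : A) : cast e x = x.
Proof. by rewrite (proof_irrelevance _ e erefl). Qed.

Definition hom_cast (C : category) (a a' b b' : C) (ea : a = a') (eb : b = b')
    (f : hom a b) : hom a' b' :=
  ecast z (hom z b') ea (ecast z (hom a z) eb f).

Lemma hom_cast_id (C : category) (a b : C) (ea : a = a) (eb : b = b)
    (f : hom a b) : hom_cast ea eb f = f.
Proof.
by rewrite (proof_irrelevance _ ea erefl) (proof_irrelevance _ eb erefl).
Qed.

(** Once the object maps are identified, each [e a] is a loop, so proof irrelevance trivialises its
    transport; the functor laws are mere propositions. *)
Lemma functor_ext (C D : category) (K L : functor C D)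
    (e : forall a, K a = L a) :
  (forall (a b : C) (f : hom a b), hom_cast (e a) (e b) (fmap K f) = fmap L f) ->
  K = L.
Proof.
case: K L e => [k kf k1 kM] [l lf l1 lM] /= e.
have kl : k = l by apply: functional_extensionality.
case: l / kl lf l1 lM e => lf l1 lM e kf_lf.
have {}kf_lf : kf = lf.
  apply: functional_extensionality_dep => a.
  apply: functional_extensionality_dep => b.
  apply: functional_extensionality => f.
  by rewrite -kf_lf hom_cast_id.
case: lf / kf_lf l1 lM => l1 lM.
by rewrite (proof_irrelevance _ k1 l1) (proof_irrelevance _ kM lM).
Qed.

(** For a concrete category with carriers [U] and underlying maps [V], this reduces transport of
    morphisms to [cast] on elements. *)
Lemma hom_cast_fun (D : category) (U : D -> Type)
    (V : forall a b : D, hom a b -> U a -> U b)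
    (a a' b b' : D) (ea : a = a') (eb : b = b') (f : hom a b) (x : U a) :
  V _ _ (hom_cast ea eb f) (cast (congr1 U ea) x) = cast (congr1 U eb) (V _ _ f x).
Proof. by case: a' / ea; case: b' / eb. Qed.

(** Morphisms of a full subcategory ignore the membership proofs, the only data in which the
    endpoints may differ. *)
Lemma hom_cast_full (C : category) (P : C -> Prop) (a b : C) (pa pa' : P a)
    (pb pb' : P b) (ea : exist P a pa = exist P a pa' :> full_subcategory P)
    (eb : exist P b pb = exist P b pb' :> full_subcategory P) (f : hom a b) :
  hom_cast (C := full_subcategory P) ea eb f = f.
Proof.
move: ea eb; rewrite (proof_irrelevance _ pa pa') (proof_irrelevance _ pb pb').
by move=> ea eb; exact: hom_cast_id.
Qed.

Lemma restrict_id (C : category) (P : C -> Prop) (L : functor C C)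
    (HL : forall a, P a -> P (L a)) :
  L = id_functor C -> restrict_functor HL = id_functor (full_subcategory P).
Proof.
move=> eL; move: HL; rewrite eL => HL {eL}.
rewrite (proof_irrelevance _ HL (fun a Pa => Pa)) {HL}.
set K := restrict_functor _.
have e (a : full_subcategory P) : K a = id_functor _ a.
  by case: a => a Pa; congr exist; apply: proof_irrelevance.
apply: (functor_ext (e := e)) => -[a Pa] [b Pb] f.
exact: hom_cast_full.
Qed.

Lemma restrict_comp_id (C D : category) (P : C -> Prop) (Q : D -> Prop)
    (H : functor C D) (K : functor D C)
    (HPQ : forall a, P a -> Q (H a)) (KQP : forall b, Q b -> P (K b)) :
  comp_functor K H = id_functor C ->
  comp_functor (restrict_functor KQP) (restrict_functor HPQ) =
    id_functor (full_subcategory P).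
Proof.
(* The identity is traded for the restriction of [comp_functor K H], which matches the left side up
   to membership proofs. *)
move=> KH; rewrite -(@restrict_id _ P (comp_functor K H) (fun a Pa => KQP _ (HPQ a Pa)) KH).
set L := comp_functor _ _; set M := restrict_functor _.
have e a : L a = M a by congr exist; apply: proof_irrelevance.
apply: (functor_ext (e := e)) => a b f.
exact: hom_cast_full.
Qed.

Lemma restrict_inverse_functors (C D : category) (P : C -> Prop) (Q : D -> Prop)
    (H : functor C D) (K : functor D C)
    (HPQ : forall a, P a -> Q (H a)) (KQP : forall b, Q b -> P (K b)) :
  inverse_functors H K ->
  inverse_functors (restrict_functor HPQ) (restrict_functor KQP).
Proof. by case=> KH HK; split; apply: restrict_comp_id. Qed.

Lemma inverse_functors_isomorphisms (C D : category)
    (H : functor C D) (K : functor D C) :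
  inverse_functors H K ->
  is_isomorphism H /\ is_isomorphism K /\ inverse_functors H K.
Proof. by move=> HK; split; [exists K | split=> //; exists H; case: HK]. Qed.

Lemma perm_ext (X : Type) (p q : perm X) : p =1 q -> p = q.
Proof.
case: p q => [p p' pK p'K] [q q' qK q'K] /= pq.
have {}pq : p = q by apply: functional_extensionality.
case: q / pq qK q'K => qK q'K.
(* The inverse is determined by the map: [p' x = p' (p (q' x)) = q' x]. *)
have p'q' : p' = q'.
  by apply: functional_extensionality => x; rewrite -{1}[x]q'K pK.
case: q' / p'q' qK q'K => qK q'K.
by rewrite (proof_irrelevance _ pK qK) (proof_irrelevance _ p'K q'K).
Qed.

Lemma rack_eq (X : Type) (s t : X -> perm X)
    (sP : rack_axiom s) (tP : rack_axiom t) :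
  (forall x, s x =1 t x) -> Rack sP = Rack tP.
Proof.
move=> st; have {}st : s = t.
  by apply: functional_extensionality => x; apply: perm_ext.
by case: t / st tP => tP; rewrite (proof_irrelevance _ sP tP).
Qed.

Lemma glquandle_eq (X : Type) (s t : X -> perm X) (u v : perm X)
    (sP : rack_axiom s) (tP : rack_axiom t)
    (uP : GL_structure (@rack_op (Rack sP)) u)
    (vP : GL_structure (@rack_op (Rack tP)) v)
    (sQ : quandle_axiom (@rack_op (GLRack uP)))
    (tQ : quandle_axiom (@rack_op (GLRack vP))) :
  (forall x, s x =1 t x) -> u =1 v -> GLQuandle sQ = GLQuandle tQ.
Proof.
move=> st /perm_ext uv; have {}st : s = t.
  by apply: functional_extensionality => x; apply: perm_ext.
case: t / st tP vP tQ => tP vP tQ; case: v / uv vP tQ => vP tQ.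
(* The type of each law proof mentions the previous one, so they are identified in order of
   nesting. *)
case: tP / (proof_irrelevance _ sP tP) vP tQ => vP tQ.
case: vP / (proof_irrelevance _ uP vP) tQ => tQ.
by rewrite (proof_irrelevance _ sQ tQ).
Qed.

Lemma GF_obj (R : rack) : G_obj (F_obj R) = R.
Proof.
case: R => X s sP; apply: rack_eq => x a.
exact: (pinvK (rack_pi (Rack sP))).
Qed.

Lemma gl_u_diag (Q : glquandle) : rack_pi (G_obj Q) =1 gl_u Q.
Proof. by move=> x; congr (gl_u Q _); apply: (glquandleP (g := Q)). Qed.

Lemma FG_op (Q : glquandle) (x : Q) : F_op (R := G_obj Q) x =1 rack_op x.
Proof.
(* Applying [rack_pi (G_obj Q)] cancels its inverse in [F_op]; both sides become
   [gl_u Q (rack_op x a)]. *)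
move=> a; apply: (can_inj (pfunK (rack_pi (G_obj Q)))).
by rewrite F_opE (pinvK (rack_pi (G_obj Q))) gl_u_diag.
Qed.

Lemma FG_obj (Q : glquandle) : F_obj (G_obj Q) = Q.
Proof.
move: (@FG_op Q) (@gl_u_diag Q).
by case: Q => -[[X s sP] u uP] sQ op_eq u_eq; apply: glquandle_eq.
Qed.

Lemma inverse_functors_FG : inverse_functors F G.
Proof.
split.
- apply: (@functor_ext _ _ (comp_functor G F) (id_functor _) GF_obj) => R1 R2 f; apply: rack_hom_eq.
  apply: functional_extensionality => x.
  (* [GF_obj] relates racks with convertible carriers, so [cast_id] removes both casts. *)
  have := hom_cast_fun (D := RackCat) (U := rack_sort) rack_hom_fun
    (GF_obj R1) (GF_obj R2) (fmap G (fmap F f)) x.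
  by rewrite !cast_id.
- apply: (@functor_ext _ _ (comp_functor F G) (id_functor _) FG_obj) => Q1 Q2 f; apply: glrack_hom_eq.
  apply: functional_extensionality => x.
  have := hom_cast_fun (D := GLQ) (U := fun Q : glquandle => rack_sort Q)
    (fun Q1 Q2 (g : glrack_hom Q1 Q2) => rack_hom_fun g)
    (FG_obj Q1) (FG_obj Q2) (fmap F (fmap G f)) x.
  by rewrite !cast_id.
Qed.

(** An inverse of [rack_pi] in the index acts trivially and elsewhere commutes outwards, leaving its
    square in front of the medial identity of [R]. *)
Lemma F_medial (R : rack) : medial R -> medial (F_obj R).
Proof.
move=> medR.
suff medF (x y z a : R) : F_op (F_op x z) (F_op y a) = F_op (F_op x y) (F_op z a).
  exact: medF.
by rewrite !F_opE !op_rack_pi_inv -!rack_piVC medR.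
Qed.

(** Likewise, [gl_u Q] disappears from the index and its square comes out in front. *)
Lemma G_medial (Q : glquandle) : medial Q -> medial (G_obj Q).
Proof.
have [_ uC] := glrackP Q; move=> medQ x y z a.
by rewrite /= /G_op /= !op_gl_u -!uC medQ.
Qed.

Theorem theorem5p6 :
  (is_isomorphism F /\ is_isomorphism G /\ inverse_functors F G) /\
  (exists (HF : forall R : RackCat, medial_rack R -> medial_glquandle (F R))
          (HG : forall Q : GLQ, medial_glquandle Q -> medial_rack (G Q)),
     let Fmed : functor Rack_med GLQ_med := restrict_functor HF in
     let Gmed : functor GLQ_med Rack_med := restrict_functor HG in
     is_isomorphism Fmed /\ is_isomorphism Gmed /\ inverse_functors Fmed Gmed).
Proof.
split; first exact: inverse_functors_isomorphisms inverse_functors_FG.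
exists F_medial, G_medial => Fmed Gmed.
apply: inverse_functors_isomorphisms.
exact: restrict_inverse_functors inverse_functors_FG.
Qed.
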